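(* Let $P(T,X)=3X^4-4X^3+1+3T^2\in\mathbf{Q}[T,X]$. Let $t\in\mathbf{Q}$ and let $G_t$ be the Galois group over $\mathbf{Q}$ of the specialized polynomial $P_t=P(t,X)\in\mathbf{Q}[X]$. Then $$G_t\not\cong A_4\iff t=\frac{v^3-9v}{9(1-v^2)}\ \text{ for some } v\in\mathbf{Q}\text{ with } v\neq\pm1.$$
   Context: $A_4$ denotes the alternating group on four letters. The Galois group of a nonzero polynomial in $\mathbf{Q}[X]$ is the Galois group over $\mathbf{Q}$ of its splitting field. *)

(* Defs.v *)
From HB Require Import structures.
From mathcomp Require Import all_boot all_order all_algebra.
From mathcomp Require Import all_fingroup all_solvable all_field.

Set Implicit Arguments.
Unset Strict Implicit.
Unset Printing Implicit Defensive.

Import GRing.Theory.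
Local Open Scope ring_scope.

(* The outer indeterminate is X and the inner one is T. *)
Definition PTX : {poly {poly rat}} :=
  3 *: 'X^4 - 4 *: 'X^3 + 1 + (3 *: 'X^2)%:P.

Definition specialization (t : rat) (P : {poly {poly rat}}) : {poly rat} :=
  map_poly (horner_eval t) P.

Definition is_splitting_field (L : fieldExtType rat) (p : {poly rat}) : Prop :=
  splittingFieldFor 1%AS (map_poly (in_alg L) p) {:L}%VS.

(* Main.v *)
Require Import Defs.
From Stdlib Require Import Classical.
From HB Require Import structures.
From mathcomp Require Import all_boot all_order all_algebra.
From mathcomp Require Import all_fingroup all_solvable all_field.
From mathcomp Require Import zify ring lra.

Set Implicit Arguments.
Unset Strict Implicit.
Unset Printing Implicit Defensive.

Import GRing.Theory.
Local Open Scope ring_scope.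
Import Num.Theory.

(** Put c = 1 + 3 t^2, so that the specialized polynomial is
    3 X^4 - 4 X^3 + c. Its discriminant is 3 (48 c)^2 (c - 1), which is
    (144 c t)^2 because c - 1 = 3 t^2, a rational square: unless t = 0, the
    Galois group permutes the roots evenly ([quartic_disc], [gal_perm_even]). What
    decides between A_4 and a smaller group is the cubic resolvent
    Z^3 - 3 c Z - 2 c, whose roots are 3/2 (x1 x2 + x3 x4) and its conjugates
    ([resolvent_factor]).

    If the resolvent has no rational root (so that t != 0, as - 1 is a root
    for t = 0) then it is irreducible, so 3 divides
    the degree of the splitting field L. The quartic is then irreducible too:
    it has no rational root because
    3 X^4 - 4 X^3 + 1 = (X - 1)^2 (3 X^2 + 2 X + 1) is nonnegative, hence never
    equal to - 3 t^2 ([no_root_quartic]), and a factorization into two quadratics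
    would give a rational root of the resolvent ([quartic_irreducible]). So 4
    divides the degree of L as well, and a subgroup of A_4 whose order is
    divisible by 12 is A_4 ([Gal_isog_Alt4]).

    Conversely, a group isomorphic to A_4 contains an element of order 3. It
    fixes one root of the quartic and cycles the other three, hence it moves
    every root of the resolvent, and none of these can be rational
    ([order3_resolvent_root_free], [Gal_not_isog_Alt4]).

    Finally (Z + 1)^2 (Z - 2) = 3 t^2 (3 Z + 2) is a rational curve in (Z, t):
    (Z - 2) / (3 (3 Z + 2)) has to be a square w^2, Z is a function of w, and
    v = - 3 w turns t = w (Z + 1) into the stated fraction
    ([resolvent_root_param]). *)

(** * The quartic and its cubic resolvent *)

Definition quartic (R : nzRingType) (c : R) : {poly R} :=
  3 *: 'X^4 - 4 *: 'X^3 + c%:P.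

(** The usual resolvent of a monic quartic has the roots x1 x2 + x3 x4; scaling
    them by 3/2 clears the denominators of the coefficients. *)
Definition resolvent (R : nzRingType) (c : R) : {poly R} :=
  'X^3 - (3 * c) *: 'X - (2 * c)%:P.

Lemma specialization_PTX t : specialization t PTX = quartic (1 + 3 * t ^+ 2).
Proof.
rewrite /specialization /PTX /quartic -[X in map_poly _ X]addrA rmorphD; congr (_ + _).
  rewrite -!mul_polyC !(rmorphD, rmorphN, rmorphXn, rmorphM) /=.
  by rewrite !map_polyC map_polyX /= /horner_eval !hornerC.
rewrite rmorphD rmorph1 /= map_polyC /= /horner_eval !hornerE.
by rewrite polyCD.
Qed.

Lemma map_quartic (R S : nzRingType) (f : {rmorphism R -> S}) c :
  map_poly f (quartic c) = quartic (f c).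
Proof.
rewrite /quartic -!mul_polyC !(rmorphD, rmorphN, rmorphXn, rmorphM) /=.
by rewrite !map_polyC map_polyX /= !rmorph1.
Qed.

Lemma map_resolvent (R S : nzRingType) (f : {rmorphism R -> S}) c :
  map_poly f (resolvent c) = resolvent (f c).
Proof.
rewrite /resolvent -!mul_polyC !(rmorphD, rmorphN, rmorphXn, rmorphM) /=.
by rewrite !map_polyC map_polyX /= !rmorph1.
Qed.

Lemma horner_quartic (R : comNzRingType) (c x : R) :
  (quartic c).[x] = 3 * x ^+ 4 - 4 * x ^+ 3 + c.
Proof. by rewrite !hornerE. Qed.

Lemma horner_resolvent (R : comNzRingType) (c z : R) :
  (resolvent c).[z] = z ^+ 3 - 3 * c * z - 2 * c.
Proof. by rewrite !hornerE. Qed.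

Lemma coef_quartic (R : nzRingType) (c : R) :
  [/\ (quartic c)`_0 = c, (quartic c)`_1 = 0, (quartic c)`_2 = 0,
      (quartic c)`_3 = - 4 & (quartic c)`_4 = 3].
Proof.
rewrite /quartic; split;
by rewrite !(coefD, coefN, coefZ, coefXn, coefC) /=
  ?(mulr0, mulr1, oppr0, addr0, add0r, subr0, sub0r).
Qed.

Lemma size_quartic (F : fieldType) (c : F) : 3 != 0 :> F -> size (quartic c) = 5%N.
Proof.
move=> n3; rewrite /quartic -addrA size_polyDl size_scale ?size_polyXn //.
rewrite (leq_ltn_trans (size_polyD _ _)) // gtn_max size_polyN.
rewrite (leq_ltn_trans (size_scale_leq _ _)) ?size_polyXn //.
by rewrite (leq_ltn_trans (size_polyC_leq1 _)).
Qed.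

Lemma size_resolvent (R : nzRingType) (c : R) : size (resolvent c) = 4%N.
Proof.
rewrite /resolvent -addrA size_polyDl size_polyXn //.
rewrite -opprD size_polyN (leq_ltn_trans (size_polyD _ _)) // gtn_max.
rewrite (leq_ltn_trans (size_scale_leq _ _)) ?size_polyX //.
by rewrite (leq_ltn_trans (size_polyC_leq1 _)).
Qed.

(** * Rational points *)

Lemma no_root_quartic (t x : rat) : root (quartic (1 + 3 * t ^+ 2)) x -> t = 0.
Proof.
rewrite rootE horner_quartic => /eqP e.
(* 3 x^2 + 2 x + 1 = (x + 1)^2 + 2 x^2 *)
have h : ((x - 1) * (x + 1)) ^+ 2 + 2 * ((x - 1) * x) ^+ 2 + 3 * t ^+ 2 = 0.
  by rewrite -e; ring.
apply/eqP; rewrite -sqrf_eq0; apply/eqP.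
have := sqr_ge0 ((x - 1) * (x + 1)); have := sqr_ge0 ((x - 1) * x).
have := sqr_ge0 t; lra.
Qed.

(** The equation of the resolvent reads (z + 1)^2 (z - 2) = 3 t^2 (3 z + 2).
    Away from z = - 1, which only occurs for t = 0, it makes
    3 (z - 2) / (3 z + 2) the square of v = - 3 t / (z + 1), and then z is a
    rational function of v. *)
Lemma resolvent_root_param (t : rat) :
  (exists z, root (resolvent (1 + 3 * t ^+ 2)) z) <->
  exists v : rat, v <> 1 /\ v <> -1 /\
    t = (v ^+ 3 - 9 * v) / (9 * (1 - v ^+ 2)).
Proof.
split=> [[z]|[v [v1 [vN1 tE]]]].
  rewrite rootE horner_resolvent => /eqP e.
  have {}e : (z + 1) ^+ 2 * (z - 2) = 3 * t ^+ 2 * (3 * z + 2).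
    by apply/eqP; rewrite -subr_eq0 -e; apply/eqP; ring.
  have [t0|t0] := eqVneq t 0.
    by exists 0; rewrite t0; split=> //; split=> //; field.
  have n2 : 3 * z + 2 != 0.
    apply/eqP => z2; have zE : z = - 2 / 3 by lra.
    by move: e; rewrite z2 zE mulr0 => /eqP; apply/negP.
  have n1 : z + 1 != 0.
    apply/eqP => z1; have zE : z = - 1 by lra.
    move: e; rewrite zE; nra.
  pose v := - (3 * t / (z + 1)); exists v.
  have vE : (3 * z + 2) * v ^+ 2 = 3 * (z - 2).
    rewrite /v; apply: (mulIf (expf_neq0 2 n1)).
    have -> : (3 * z + 2) * (- (3 * t / (z + 1))) ^+ 2 * (z + 1) ^+ 2
       = 3 * (3 * t ^+ 2 * (3 * z + 2)) by field.
    by rewrite -e; ring.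
  have vn : 1 - v ^+ 2 != 0.
    apply/eqP=> v0; have {}v0 : v ^+ 2 = 1 by lra.
    by move: vE; rewrite v0; lra.
  split; first by move=> v1; move: vn; rewrite v1 expr1n subrr eqxx.
  split; first by move=> v1; move: vn; rewrite v1 sqrrN expr1n subrr eqxx.
  have tE : t = - (v * (z + 1) / 3) by rewrite /v; field.
  apply: (mulIf vn); rewrite {1}tE.
  have -> : (v ^+ 3 - 9 * v) / (9 * (1 - v ^+ 2)) * (1 - v ^+ 2) = (v ^+ 3 - 9 * v) / 9.
    by field.
  have : z * v ^+ 2 = (3 * (z - 2) - 2 * v ^+ 2) / 3 by lra.
  nra.
have vn : 1 - v ^+ 2 != 0.
  rewrite -[1](expr1n _ 2) subr_sqr mulf_neq0 //.
    by rewrite subr_eq0 eq_sym; apply/eqP.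
  by rewrite addrC addr_eq0; apply/eqP.
(* z solved from v^2 (3 z + 2) = 3 (z - 2) *)
exists ((2 + 2 * v ^+ 2 / 3) / (1 - v ^+ 2)).
by rewrite rootE horner_resolvent tE; apply/eqP; field.
Qed.

(** * Roots of the quartic over a field *)

Lemma prod_XsubC4 (R : comNzRingType) (a b d e : R) :
  \prod_(z <- [:: a; b; d; e]) ('X - z%:P) =
  'X^4 - (a + b + d + e) *: 'X^3
  + (a * b + a * d + a * e + b * d + b * e + d * e) *: 'X^2
  - (a * b * d + a * b * e + a * d * e + b * d * e) *: 'X + (a * b * d * e)%:P.
Proof.
rewrite !big_cons big_nil -!mul_polyC !(polyCD, polyCM); ring.
Qed.

(** The factors 3 stay on the left because the quartic is not monic and 3 may
    fail to be invertible. *)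
Lemma quartic_vieta (R : comNzRingType) (c a b d e : R) :
  quartic c = 3 *: \prod_(z <- [:: a; b; d; e]) ('X - z%:P) ->
  [/\ 3 * (a + b + d + e) = 4,
      3 * (a * b + a * d + a * e + b * d + b * e + d * e) = 0,
      3 * (a * b * d + a * b * e + a * d * e + b * d * e) = 0
    & 3 * (a * b * d * e) = c].
Proof.
rewrite prod_XsubC4 => eq_q; have [c0 c1 c2 c3 _] := coef_quartic c.
have E i : (quartic c)`_i = _ := congr1 (fun p : {poly R} => p`_i) eq_q.
move: (E 0) (E 1) (E 2) (E 3); rewrite c0 c1 c2 c3.
rewrite !(coefD, coefN, coefZ, coefXn, coefX, coefC) /=.
rewrite !(mulr0, mulr1, oppr0, addr0, add0r, subr0, sub0r).
move=> -> e1 <- e3; split=> //.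
  by apply: oppr_inj; rewrite e3 mulrN.
by apply: oppr_inj; rewrite -mulrN -e1 oppr0.
Qed.

Section Field.

Variable F : fieldType.
Hypotheses (n2 : 2 != 0 :> F) (n3 : 3 != 0 :> F).
Implicit Types (c z : F) (rs : seq F).

Lemma quartic_factor c rs :
  quartic c %= \prod_(z <- rs) ('X - z%:P) ->
  size rs = 4%N /\ quartic c = 3 *: \prod_(z <- rs) ('X - z%:P).
Proof.
move=> eq_q; have sz := size_quartic c n3.
have szr : size rs = 4%N.
  by apply: succn_inj; rewrite -sz (eqp_size eq_q) size_prod_XsubC.
have /eqpf_eq[k k0 qE] := eq_q; split=> //.
suff <- : k = 3 by [].
have [_ _ _ _ <-] := coef_quartic c; rewrite qE coefZ.
have /monicP := monic_prod_XsubC rs predT id.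
by rewrite lead_coefE size_prod_XsubC szr /= => ->; rewrite mulr1.
Qed.

(** The three values of x1 x2 + x3 x4 are the roots of
    Y^3 - s2 Y^2 + (s1 s3 - 4 s4) Y - (s1^2 s4 + s3^2 - 4 s2 s4), where the si
    are the elementary symmetric functions; here s2 = s3 = 0, 3 s1 = 4 and
    3 s4 = c. The substitution Y = 2 z / 3 accounts for the factor 8. *)
Lemma resolvent_factor c a b d e :
  quartic c = 3 *: \prod_(z <- [:: a; b; d; e]) ('X - z%:P) ->
  forall z, 8 * (resolvent c).[z] =
    (2 * z - 3 * (a * b + d * e)) * (2 * z - 3 * (a * d + b * e))
    * (2 * z - 3 * (a * e + b * d)).
Proof.
move=> /quartic_vieta[e1 e2 e3 e4] z; rewrite horner_resolvent.
pose s1 := a + b + d + e.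
pose s2 := a * b + a * d + a * e + b * d + b * e + d * e.
pose s3 := a * b * d + a * b * e + a * d * e + b * d * e.
pose s4 := a * b * d * e.
transitivity ((2 * z) ^+ 3 - (3 * s2) * (2 * z) ^+ 2
   + 9 * (s1 * s3 - 4 * s4) * (2 * z)
   - 27 * (s1 ^+ 2 * s4 + s3 ^+ 2 - 4 * s2 * s4)); last first.
  by rewrite /s1 /s2 /s3 /s4; ring.
have s20 : s2 = 0 by apply: (mulfI n3); rewrite e2 mulr0.
have s30 : s3 = 0 by apply: (mulfI n3); rewrite e3 mulr0.
have -> : 27 * (s1 ^+ 2 * s4 + s3 ^+ 2 - 4 * s2 * s4) =
   (3 * s1) ^+ 2 * (3 * s4) by rewrite s20 s30; ring.
by rewrite e1 s20 s30 -e4 -/s4; ring.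
Qed.

Lemma Vandermonde4 (x : 'rV[F]_4) : \det (Vandermonde 4 x) =
  (x 0 1 - x 0 0) * (x 0 2 - x 0 0) * (x 0 3 - x 0 0)
  * (x 0 2 - x 0 1) * (x 0 3 - x 0 1) * (x 0 3 - x 0 2).
Proof.
rewrite det_Vandermonde.
under eq_bigr => i _ do rewrite big_mkcond.
rewrite !(big_ord_recl, big_ord0) /= ?(mul1r, mulr1).
have E : (lift ord0 ord0 = 1 :> 'I_4) /\ (lift ord0 (lift ord0 ord0) = 2 :> 'I_4) /\
  (lift ord0 (lift ord0 (lift ord0 ord0)) = 3 :> 'I_4) by split; [|split]; apply: val_inj.
by case: E => -> [-> ->]; rewrite !mulrA.
Qed.

(** The square of the Vandermonde determinant is the product of the
    derivatives of the monic quartic at its roots x, which are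
    4 x^2 (x - 1). The product of the roots is c / 3, and that of the x - 1 is
    the value (c - 1) / 3 of the monic quartic at 1. *)
Lemma quartic_disc c (x : 'rV[F]_4) :
  quartic c = 3 *: \prod_(z <- [:: x 0 0; x 0 1; x 0 2; x 0 3]) ('X - z%:P) ->
  27 * \det (Vandermonde 4 x) ^+ 2 = 256 * c ^+ 2 * (c - 1).
Proof.
rewrite Vandermonde4; move: (x 0 0) (x 0 1) (x 0 2) (x 0 3) => a b d e.
move=> /quartic_vieta[e1 e2 e3 e4].
have D (p q r s : F) : 3 * (p + q + r + s) = 4 ->
  3 * (p * q + p * r + p * s + q * r + q * s + r * s) = 0 ->
  3 * (p * q * r + p * q * s + p * r * s + q * r * s) = 0 ->
  (p - q) * (p - r) * (p - s) = 4 * p ^+ 2 * (p - 1).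
  move=> f1 f2 f3; apply: (mulfI n3).
  transitivity (12 * p ^+ 3 - 3 * p ^+ 2 * (3 * (p + q + r + s))
    + 2 * p * (3 * (p * q + p * r + p * s + q * r + q * s + r * s))
    - (3 * (p * q * r + p * q * s + p * r * s + q * r * s))); first by ring.
  by rewrite f1 f2 f3; ring.
have Da := D a b d e e1 e2 e3.
have Db : (b - a) * (b - d) * (b - e) = 4 * b ^+ 2 * (b - 1).
  by apply: (D b a d e); [rewrite -e1|rewrite -e2|rewrite -e3]; ring.
have Dd : (d - a) * (d - b) * (d - e) = 4 * d ^+ 2 * (d - 1).
  by apply: (D d a b e); [rewrite -e1|rewrite -e2|rewrite -e3]; ring.
have De : (e - a) * (e - b) * (e - d) = 4 * e ^+ 2 * (e - 1).
  by apply: (D e a b d); [rewrite -e1|rewrite -e2|rewrite -e3]; ring.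
transitivity (27 * (((a - b) * (a - d) * (a - e)) * ((b - a) * (b - d) * (b - e))
   * ((d - a) * (d - b) * (d - e)) * ((e - a) * (e - b) * (e - d)))).
  by ring.
rewrite Da Db Dd De.
transitivity (256 * (3 * (a * b * d * e)) ^+ 2 *
  (3 - 3 * (a + b + d + e)
   + 3 * (a * b + a * d + a * e + b * d + b * e + d * e)
   - 3 * (a * b * d + a * b * e + a * d * e + b * d * e) + 3 * (a * b * d * e))).
  by ring.
by rewrite e1 e2 e3 e4; ring.
Qed.

(** If (v2 X^2 + v1 X + v0) (u2 X^2 + u1 X + u0) is the quartic, the product of
    the roots of the one factor plus that of the other is
    (v0 u2 + v2 u0) / 3, so (v0 u2 + v2 u0) / 2 is a root of the resolvent. *)
Lemma quartic_irreducible c :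
  (forall x, ~~ root (quartic c) x) -> (forall z, ~~ root (resolvent c) z) ->
  irreducible_poly (quartic c).
Proof.
move=> nrq nrr; have sz := size_quartic c n3.
split=> [|q sq1 /dvdpP[r qE]]; first by rewrite sz.
have q0 : quartic c != 0 by rewrite -size_poly_eq0 sz.
have /norP[r_n0 q_n0] : ~~ ((r == 0) || (q == 0)) by rewrite -mulf_eq0 -qE.
have sE : (size r + size q = 6)%N.
  have := size_mul r_n0 q_n0; rewrite -qE sz.
  by move: r_n0; rewrite -size_poly_gt0; case: (size r) => //= m _ ->.
have nr2 p : p %| quartic c -> size p != 2%N.
  move=> /dvdpP[u qE']; apply/eqP => /poly2_root[y ry].
  by move: (nrq y); rewrite qE' rootM ry orbT.
have dq : q %| quartic c by rewrite qE dvdp_mull.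
have dr : r %| quartic c by rewrite qE dvdp_mulr.
have r_gt0 : (0 < size r)%N by rewrite size_poly_gt0.
have q_gt0 : (0 < size q)%N by rewrite size_poly_gt0.
have [sr1|sr1] := eqVneq (size r) 1%N.
  by rewrite -dvdp_size_eqp // sz; move: sE; rewrite sr1 add1n => -[->].
have sq3 : size q = 3%N.
  by move: (nr2 _ dq) (nr2 _ dr) sr1 sq1 r_gt0 q_gt0 sE;
     move: (size q) (size r) => m n; lia.
have sr3 : size r = 3%N by move: sE; rewrite sq3; move: (size r) => n; lia.
have [c0 c1 c2 c3 c4] := coef_quartic c.
have q3 i : q`_i.+3 = 0 by rewrite nth_default ?sq3.
have r3 i : r`_i.+3 = 0 by rewrite nth_default ?sr3.
have E i : (quartic c)`_i = _ := congr1 (fun p : {poly F} => p`_i) qE.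
move: (E 0) (E 1) (E 2) (E 3) (E 4); rewrite c0 c1 c2 c3 c4 !coefM.
rewrite !(big_ord_recl, big_ord0) /= /bump /= ?(q3, r3) ?(mul0r, mulr0, addr0, add0r).
rewrite !(addn0, add0n, add1n, subn0, subnn, subSS).
move: (q`_0) (q`_1) (q`_2) (r`_0) (r`_1) (r`_2) => u0 u1 u2 v0 v1 v2.
move=> cE A B C D; pose w := v0 * u2 + v2 * u0.
have [] := negP (nrr (w / 2)).
rewrite rootE horner_resolvent -(mulrI_eq0 _ (mulfI (expf_neq0 3 n2))).
have -> : 2 ^+ 3 * ((w / 2) ^+ 3 - 3 * c * (w / 2) - 2 * c) =
    w ^+ 3 - 4 * 3 * c * w - (- 4) ^+ 2 * c by field.
rewrite cE C D; apply/eqP.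
(* The coefficients of X^2 and X, which vanish, lead the two products. *)
transitivity ((v0 * u2 + (v1 * u1 + v2 * u0)) * (v0 * u2 - v2 * u0) ^+ 2
   - (v0 * u1 + v1 * u0) * (v1 * v0 * u2 ^+ 2 + v2 ^+ 2 * u1 * u0)).
  by rewrite /w; ring.
by rewrite -A -B !mul0r subrr.
Qed.

(** The orbit of a consists of three roots of the quartic, and the fourth root
    e is fixed because the sum of the roots is. If s fixed the resolvent root
    that belongs to a' b' + d' e, with s: a' -> b' -> d' -> a', then
    a' b' + d' e = b' d' + a' e, that is (a' - d') (b' - e) = 0. *)
Lemma order3_resolvent_root_free (s : {rmorphism F -> F}) c z a rs :
  quartic c = 3 *: \prod_(z <- rs) ('X - z%:P) -> size rs = 4%N -> s c = c ->
  a \in rs -> s a != a -> s (s (s a)) = a ->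
  s z = z -> ~~ root (resolvent c) z.
Proof.
move=> qE szr sc ars sa s3a sz; apply/negP => rz.
have root_rs y : (y \in rs) = root (quartic c) y.
  by rewrite qE rootZ // root_prod_XsubC.
have s_rs y : y \in rs -> s y \in rs.
  by rewrite !root_rs -{2}sc -map_quartic; apply: rmorph_root.
have s_inj : injective s by apply: fmorph_inj.
have brs := s_rs _ ars; have drs := s_rs _ brs.
set b := s a in brs drs sa s3a; set d := s b in drs s3a.
have nba : b != a by [].
have ndb : d != b by rewrite /d /b inj_eq.
have nda : d != a by rewrite -s3a inj_eq // eq_sym.
have [e rsE] : exists e, perm_eq rs [:: a; b; d; e].
  have P1 := perm_to_rem ars; set r1 := rem a rs in P1.
  have br1 : b \in r1 by move: brs; rewrite (perm_mem P1) inE (negPf nba).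
  have P2 := perm_to_rem br1; set r2 := rem b r1 in P2.
  have dr2 : d \in r2.
    by move: drs; rewrite (perm_mem P1) inE (perm_mem P2) inE (negPf nda) (negPf ndb).
  have P3 := perm_to_rem dr2; set r3 := rem d r2 in P3.
  have P : perm_eq rs [:: a, b, d & r3].
    apply: perm_trans P1 _; rewrite perm_cons.
    by apply: perm_trans P2 _; rewrite perm_cons.
  move: (perm_size P); rewrite szr; case: r3 P {P3} => [|e [|]] // P _.
  by exists e.
have {}qE : quartic c = 3 *: \prod_(z <- [:: a; b; d; e]) ('X - z%:P).
  by rewrite qE; congr (_ *: _); apply: perm_big.
have [e1 _ _ _] := quartic_vieta qE.
have se : s e = e.
  have /(congr1 s) := e1; rewrite rmorphM !rmorph_nat !rmorphD.
  rewrite -/b -/d /= s3a -{1}e1 => /(mulfI n3).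
  by rewrite [b + d + a](_ : _ = a + b + d); [move/addrI | ring].
have sy a' b' d' : s a' = b' -> s b' = d' -> s d' = a' -> a' != d' -> b' != e ->
    2 * z - 3 * (a' * b' + d' * e) != 0.
  move=> sa' sb' sd' nab nde; apply/eqP => y0.
  have /(congr1 s) := y0.
  rewrite rmorphB !rmorphM !rmorph_nat rmorphD !rmorphM sz sa' sb' sd' se rmorph0.
  rewrite -y0 => /eqP; rewrite -subr_eq0.
  have -> : 2 * z - 3 * (b' * d' + a' * e) - (2 * z - 3 * (a' * b' + d' * e))
    = 3 * ((a' - d') * (b' - e)) by ring.
  by rewrite !mulf_eq0 !subr_eq0 (negPf n3) (negPf nab) (negPf nde).
have ne y : y \in [:: a; b; d] -> y != e.
  move=> yin; apply/eqP => ye; move: yin se; rewrite ye !inE.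
  case/or3P => /eqP -> /eqP; first by apply/negP.
  - by rewrite -/d; apply/negP.
  - by rewrite s3a eq_sym; apply/negP.
have /eqP := resolvent_factor qE z; rewrite (rootP rz) mulr0 eq_sym.
rewrite -[X in X == 0]mulrA !mulf_eq0.
rewrite (negPf (sy a b d _ _ _ _ _)) ?ne ?inE ?eqxx ?orbT //; last by rewrite eq_sym.
rewrite [a * d]mulrC (negPf (sy d a b _ _ _ _ _)) ?ne ?inE ?eqxx ?orbT //.
rewrite [a * e + _]addrC (negPf (sy b d a _ _ _ _ _)) ?ne ?inE ?eqxx ?orbT //.
Qed.

End Field.

(** * Automorphisms as permutations of the roots *)

Lemma gal_fix_base (F : fieldType) (L : splittingFieldType F) (E : {subfield L})
  (g : gal_of E) (k : F) : g k%:A = k%:A.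
Proof. by rewrite linearZ /= rmorph1. Qed.

Lemma gal_eq_on_gens (F : fieldType) (L : splittingFieldType F) (rs : seq L)
    (g h : gal_of {:L}) :
  <<1 & rs>>%VS = {:L}%VS -> {in rs, g =1 h} -> g = h.
Proof.
move=> genL eq_gh; apply/eqP/gal_eqP => y _.
have fixr : (<<1 & rs>> <= fixedField [set (g * h^-1)%g])%VS.
  apply/Fadjoin_seqP; split=> [|z zrs]; first exact: sub1v.
  apply/fixedFieldP; rewrite ?memvf // => _ /set1P ->.
  by rewrite galM ?memvf // eq_gh // -galM ?memvf // mulgV gal_id.
have /fixedFieldP : y \in fixedField [set (g * h^-1)%g].
  by apply: (subvP fixr); rewrite genL memvf.
move=> /(_ (memvf _) _ (set11 _)) /(congr1 h).
by rewrite -galM ?memvf // -mulgA mulVg mulg1.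
Qed.

(** The action on the roots, as permutations of their indices. The product of
    permutations and that of automorphisms both apply the left factor first,
    so this is a morphism. *)
Lemma gal_perm_rep (F : fieldType) (L : splittingFieldType F) n (x : 'I_n -> L) :
  injective x -> <<1 & codom x>>%VS = {:L}%VS ->
  (forall (g : gal_of {:L}) i, g (x i) \in codom x) ->
  exists f : gal_of {:L} -> 'S_n,
    [/\ {morph f : g h / (g * h)%g}, injective f & forall g i, x (f g i) = g (x i)].
Proof.
move=> x_inj genL Gx.
pose idx g i := iinv (Gx g i).
have xE g i : x (idx g i) = g (x i) by apply: f_iinv.
have idx_inj g : injective (idx g).
  by move=> i j /(congr1 x); rewrite !xE => /fmorph_inj /x_inj.
pose f g := perm (@idx_inj g).
have fE g i : x (f g i) = g (x i) by rewrite permE.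
exists f; split=> // [g h|g h eq_f].
  by apply/permP => i; apply: x_inj; rewrite permM !fE galM ?memvf.
apply: (gal_eq_on_gens genL) => _ /codomP[i ->].
by rewrite -!fE eq_f.
Qed.

Lemma det_Vandermonde_perm (F : fieldType) n (x : 'rV[F]_n) (s : 'S_n) :
  \det (Vandermonde n (\row_i x 0 (s i))) = (-1) ^+ s * \det (Vandermonde n x).
Proof.
have -> : Vandermonde n (\row_i x 0 (s i)) = col_perm s (Vandermonde n x).
  by apply/matrixP=> i j; rewrite !mxE.
by rewrite col_permE det_mulmx det_perm odd_permV mulrC.
Qed.

(** An automorphism multiplies the Vandermonde determinant of the roots by the
    sign of the permutation that it induces. *)
Lemma gal_perm_even (F : fieldType) (L : splittingFieldType F) n (x : 'I_n -> L)
    (g : gal_of {:L}) (s : 'S_n) (d : L) :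
  2 != 0 :> L -> (forall i, x (s i) = g (x i)) ->
  d = \det (Vandermonde n (\row_i x i)) -> d != 0 -> g d = d -> ~~ odd_perm s.
Proof.
move=> n2 xE dE d0 gd; apply/negP => so.
have : g d = - d.
  rewrite {1}dE -det_map_mx.
  have -> : map_mx g (Vandermonde n (\row_i x i)) =
     Vandermonde n (\row_i (\row_i x i) 0 (s i)).
    by apply/matrixP=> i j; rewrite !mxE rmorphXn xE.
  by rewrite det_Vandermonde_perm -dE so expr1 mulN1r.
rewrite gd => /eqP; rewrite -addr_eq0 -mulr2n -mulr_natl mulf_eq0.
by rewrite (negPf n2) (negPf d0).
Qed.

(** The minimal polynomial of y is p up to a factor, so the degree of the
    subfield generated by y is that of p. *)
Lemma irreducible_dvd_dim (F : fieldType) (L : fieldExtType F) (p : {poly F}) (y : L) :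
  irreducible_poly p -> root (map_poly (in_alg L) p) y -> ((size p).-1 %| \dim {:L})%N.
Proof.
move=> [p1 irr] py.
have [q qE] : exists q, minPoly 1 y = map_poly (in_alg L) q.
  by apply/polyOver1P; apply: minPolyOver.
have qp : q %| p.
  rewrite -(dvdp_map (in_alg L)) -qE; apply: minPoly_dvdp => //.
  by apply/polyOver1P; exists p.
have sq : size q = (adjoin_degree 1 y).+1.
  by rewrite -(size_map_poly (in_alg L)) -qE size_minPoly.
have/eqp_size <- : q %= p by apply: irr => //; rewrite sq.
rewrite sq /=; have := dim_Fadjoin 1 y; rewrite dimv1 muln1 => <-.
by apply: field_dimS; apply: subvf.
Qed.

Lemma natS_neq0 (L : fieldExtType rat) k : k.+1%:R != 0 :> L.
Proof. by rewrite -(rmorph_nat (in_alg L)) fmorph_eq0 pnatr_eq0. Qed.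

Lemma card_Alt4 : #|('Alt_('I_4))%g| = 12%N.
Proof.
by apply/eqP; rewrite -(eqn_pmul2l (isT : 0 < 2)%N) card_Alt card_ord.
Qed.

Lemma galois_rat (L : splittingFieldType rat) : galois 1 {:L}.
Proof.
rewrite /galois sub1v normalFieldf andbT /=.
apply/separableP => y _; apply: pcharf0_separable.
by move=> p; rewrite pchar_lalg pchar_num.
Qed.

Lemma card_gal_rat (L : splittingFieldType rat) :
  #|'Gal({:L} / 1)%g| = \dim {:L}.
Proof. by rewrite -(galois_dim (galois_rat L)) dimv1 divn1. Qed.

(** * The Galois group of the quartic *)

(** The hypothesis t != 0 is what separates the roots: for t = 0 the
    quartic has the double root 1. *)
Lemma Gal_isog_Alt4 (t : rat) (L : splittingFieldType rat)
  (hL : is_splitting_field L (quartic (1 + 3 * t ^+ 2))) : t != 0 ->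
  (forall z, ~~ root (resolvent (1 + 3 * t ^+ 2)) z) ->
  'Gal({:L} / 1) \isog 'Alt_('I_4).
Proof.
set c := 1 + _; move=> t0 nrr.
have nL := natS_neq0 L.
have [rs qE genL] := hL; rewrite map_quartic in qE.
have [szr {}qE] := quartic_factor (nL 2%N) qE.
pose x (i : 'I_4) := nth 0 rs i.
have codomx : codom x =i rs.
  move=> y; apply/codomP/idP => [[i ->]|/(nthP 0)[i ilt <-]].
    by rewrite mem_nth ?szr.
  by rewrite szr in ilt; exists (Ordinal ilt).
have rsE : rs = [:: x 0; x 1; x 2; x 3].
  by rewrite /x /=; move: szr; case: (rs) => [|? [|? [|? [|? [|]]]]].
(* The Vandermonde determinant d satisfies 3 d = +- 16 c t, so it is rational
   and fixed by the whole group. *)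
pose d := \det (Vandermonde 4 (\row_i x i)).
have disc : 27 * d ^+ 2 = 256 * c%:A ^+ 2 * (c%:A - 1).
  by apply: (quartic_disc (nL 2%N)); rewrite !mxE -rsE.
have c0 : c != 0 by rewrite /c; have := sqr_ge0 t; nra.
have dE : (3 * d) ^+ 2 = (16 * c%:A * t%:A) ^+ 2.
  apply: (mulfI (nL 2%N)).
  transitivity (27 * d ^+ 2); first by ring.
  rewrite disc /c scalerDl scale1r -[(3 * _)%:A]/(in_alg L _).
  by rewrite rmorphM rmorphXn rmorph_nat /=; ring.
have d0 : d != 0.
  apply/eqP => d0; move/eqP: dE; rewrite d0 mulr0 expr0n /= eq_sym sqrf_eq0.
  by rewrite !mulf_eq0 !scaler_eq0 oner_eq0 !orbF (negPf c0) (negPf t0) (negPf (nL 15%N)).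
have gd (g : gal_of {:L}) : g d = d.
  have gE (k : L) : 3 * d = k -> g k = k -> g d = d.
    by move=> kE gk; apply: (mulfI (nL 2%N)); rewrite kE -gk -kE rmorphM rmorph_nat.
  have gk : g (16 * c%:A * t%:A) = 16 * c%:A * t%:A.
    by rewrite !rmorphM rmorph_nat /= !gal_fix_base.
  move/eqP: dE; rewrite eqf_sqr => /orP[] /eqP /gE; apply => //.
  by rewrite rmorphN; congr (- _).
have x_inj : injective x.
  have : uniq rs.
    move: d0; rewrite /d Vandermonde4 !mxE rsE !mulf_eq0 !subr_eq0.
    rewrite !negb_or /= !inE !negb_or andbT !(eq_sym (x 0)) !(eq_sym (x 1)).
    rewrite !(eq_sym (x 2)).
    by move=> /andP[/andP[/andP[/andP[/andP[-> ->] ->] ->] ->] ->].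
  move=> urs i j /eqP; rewrite /x nth_uniq ?szr // => /eqP; exact: val_inj.
have genx : <<1 & codom x>>%VS = {:L}%VS.
  by rewrite -genL; apply/eqP; rewrite eqEsubv !adjoin_seqSr // => y; rewrite codomx.
have Gx (g : gal_of {:L}) i : g (x i) \in codom x.
  have rs_root y : (y \in codom x) = root (quartic c%:A) y.
    by rewrite codomx qE rootZ ?nL // root_prod_XsubC.
  have := codom_f x i; rewrite !rs_root => r.
  by rewrite -(gal_fix_base g) -(map_quartic g) rmorph_root.
have [f [fM f_inj fE]] := gal_perm_rep x_inj genx Gx.
have d12 : (12 %| #|'Gal({:L} / 1)%g|)%N.
  (* 4 and 3 are the degrees of the quartic and of its resolvent. *)
  rewrite card_gal_rat (@Gauss_dvd 4 3) //; apply/andP; split.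
    rewrite -[4%N]/(5.-1) -(size_quartic c (_ : 3 != 0)) //.
    apply: (@irreducible_dvd_dim _ _ _ (x 0)).
      apply: quartic_irreducible => // y; apply: contraNN t0 => /no_root_quartic -> //.
    by rewrite map_quartic qE rootZ ?nL // root_prod_XsubC rsE inE eqxx.
  rewrite -[3%N]/(4.-1) -(size_resolvent c).
  pose z := (3 * (x 0 * x 1 + x 2 * x 3)) / 2.
  apply: (@irreducible_dvd_dim _ _ _ z).
    by apply: cubic_irreducible; rewrite // size_resolvent.
  rewrite map_resolvent rootE -(mulrI_eq0 _ (mulfI (nL 7%N))).
  rewrite rsE in qE; rewrite (resolvent_factor (nL 2%N) qE).
  have -> : 2 * z = 3 * (x 0 * x 1 + x 2 * x 3).
     by rewrite /z mulrC divfK // (nL 1%N).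
  by rewrite subrr !mul0r.
pose fm := Morphism (in2W fM :
  {in 'Gal({:L} / 1)%g &, {morph f : g h / (g * h)%g >-> (g * h)%g}}).
have fm_inj : ('injm fm)%g by apply/injmP => g h _ _; apply: f_inj.
suff <- : (fm @* 'Gal({:L} / 1) = 'Alt_('I_4))%g by apply: sub_isog.
apply/eqP; rewrite eqEcard; apply/andP; split.
  apply/subsetP => _ /morphimP[g _ _ ->].
  by rewrite Alt_even; apply: (gal_perm_even (nL 1%N) (fE g) erefl d0 (gd g)).
by rewrite card_injm // card_Alt4; apply: dvdn_leq.
Qed.

Lemma Gal_not_isog_Alt4 (t z : rat) (L : splittingFieldType rat)
  (hL : is_splitting_field L (quartic (1 + 3 * t ^+ 2))) :
  root (resolvent (1 + 3 * t ^+ 2)) z ->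
  ~ ('Gal({:L} / 1) \isog 'Alt_('I_4)).
Proof.
set c := 1 + _; move=> rz isoG.
have nL := natS_neq0 L.
have [rs qE genL] := hL; rewrite map_quartic in qE.
have [szr {}qE] := quartic_factor (nL 2%N) qE.
have [|g _ og] := @Cauchy _ 3 ('Gal({:L} / 1))%G isT.
  by rewrite (card_isog isoG) card_Alt4.
have [fixg|/allPn[y yrs gy]] := boolP (all (fun y => g y == y) rs).
  have g1 : g = 1%g.
    by apply: (gal_eq_on_gens genL) => y /(allP fixg) /eqP; rewrite gal_id.
  by move: og; rewrite g1 order1.
have g3 : g (g (g y)) = y.
  suff : (g ^+ 3)%g y = y by rewrite !expgS expg0 mulg1 !galM ?memvf.
  by rewrite -og expg_order gal_id.
have /negP[] := order3_resolvent_root_free (nL 2%N) qE szr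
  (gal_fix_base g c) yrs gy g3 (gal_fix_base g z).
by rewrite -map_resolvent fmorph_root.
Qed.

Theorem proposition4p3 (t : rat) (L : splittingFieldType rat)
    (hL : is_splitting_field L (specialization t PTX)) :
  ~ ('Gal({:L} / 1) \isog 'Alt_('I_4)) <->
  exists v : rat, v <> 1 /\ v <> -1 /\
    t = (v ^+ 3 - 9 * v) / (9 * (1 - v ^+ 2)).
Proof.
rewrite specialization_PTX in hL.
rewrite -resolvent_root_param; split=> [not_iso|[z rz]]; last first.
  exact: Gal_not_isog_Alt4 hL rz.
have [//|no_root] := classic (exists z, root (resolvent (1 + 3 * t ^+ 2)) z).
have [t0|t0] := eqVneq t 0.
  (* For t = 0 the resolvent is (Z + 1)^2 (Z - 2). *)
  exists (- 1); rewrite rootE horner_resolvent t0; apply/eqP; ring.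
case: not_iso; apply: (Gal_isog_Alt4 hL t0) => z.
by apply/negP => rz; apply: no_root; exists z.
Qed.
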